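(* A regular space $X$ is regular functionally compact ($RFC$) if and only if $X$ is $R$-closed and the following holds: for every infinite set $A\subseteq X$ and every $\theta^{\omega}$-closed set $C\subseteq X$, if $A$ does not $\theta(\omega)$-converge to $X\setminus C$, then $C$ is a complete accumulation set of $A$.
   Context: Regular spaces are assumed Hausdorff; all neighborhoods are open; $\mathrm{cl}\,M=\overline M$ is the closure in $X$. An $R$-closed space is a regular space that is closed in every regular space containing it as a subspace. A regular space $X$ is $RFC$ if every continuous function from $X$ onto a regular space is closed. A neighborhood $U$ of a point $x$ is an $\omega$-hull of $x$ if there is a sequence of neighborhoods $\{U_i\}_{i=1}^\infty$ of $x$ with $\mathrm{cl}\,U_i\subseteq U_{i+1}$ and $U_i\subseteq U$ for every $i$. $\theta^\omega$-closure: $x\notin\mathrm{cl}_{\theta^\omega}M$ iff there is an $\omega$-hull $U$ of $x$ with $U\cap M=\emptyset$. A set $M\subseteq X$ is $\theta^\omega$-closed if $M=\mathrm{cl}_{\theta^\omega}M$. A set $C$ is a complete accumulation set of a set $A$ if $|U\cap A|=|A|$ for every open set $U\supseteq C$. For a set $B\subseteq X$, an open cover of $B$ is a family of open subsets of $X$ whose union contains $B$. An open cover $\mathcal V$ is a shrinkable refinement of an open cover $\mathcal U$ if for each $V\in\mathcal V$ there is $U\in\mathcal U$ with $\overline V\subseteq U$. An open cover $\mathcal V$ is a regular refinement of $\mathcal U$ if $\mathcal V$ refines $\mathcal U$ and $\mathcal V$ is a shrinkable refinement of itself. An open cover of $B$ is regular if it has a regular refinement that is an open cover of $B$. A set $A$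 $\theta(\omega)$-converges to a set $B$ if for every regular cover $\gamma$ of $B$ there is a finite family $\{U_{\alpha_i}\}_{i=1}^s\subseteq\gamma$ such that $|A\setminus\bigcup_{i=1}^s U_{\alpha_i}|<|A|$. *)

(* Defs.v *)
From mathcomp Require Import all_boot all_order all_algebra.
From mathcomp Require Import all_classical all_reals all_analysis.

Set Implicit Arguments.
Unset Strict Implicit.
Unset Printing Implicit Defensive.

Local Open Scope classical_set_scope.
Local Open Scope card_scope.

(* The library's [regular_space] does not include the Hausdorff axiom. *)
Definition regular_hausdorff (X : topologicalType) : Prop :=
  regular_space X /\ hausdorff_space X.

Definition topological_embedding (X Y : topologicalType) (f : X -> Y) : Prop :=
  injective f /\
  forall U : set X, open U <-> exists2 V : set Y, open V & f @^-1` V = U.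

(* "[Y] contains [X] as a subspace" is rendered by an embedding of [X] in [Y],
   whose range is the copy of [X] in [Y]. *)
Definition R_closed (X : topologicalType) : Prop :=
  regular_hausdorff X /\
  forall (Y : topologicalType) (f : X -> Y),
    regular_hausdorff Y -> topological_embedding f -> closed (range f).

Definition closed_map (X Y : topologicalType) (f : X -> Y) : Prop :=
  forall M : set X, closed M -> closed (f @` M).

Definition RFC (X : topologicalType) : Prop :=
  regular_hausdorff X /\
  forall (Y : topologicalType) (f : X -> Y),
    regular_hausdorff Y -> continuous f -> range f = [set: Y] -> closed_map f.

(* [A #<= B] is the library's comparison of cardinals, and [A #= B] is
   equality of cardinals; the strict order is not provided. *)
Definition card_lt (T U : Type) (A : set T) (B : set U) : Prop :=
  A #<= B /\ ~ (B #<= A).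

Definition omega_hull (X : topologicalType) (x : X) (U : set X) : Prop :=
  open_nbhs x U /\
  exists V : nat -> set X, forall i : nat,
    [/\ open_nbhs x (V i), closure (V i) `<=` V i.+1 & V i `<=` U].

Definition theta_omega_closure (X : topologicalType) (M : set X) : set X :=
  [set x | ~ exists2 U : set X, omega_hull x U & U `&` M = set0].

Definition theta_omega_closed (X : topologicalType) (M : set X) : Prop :=
  M = theta_omega_closure M.

Definition complete_accumulation_set (X : topologicalType) (C A : set X)
    : Prop :=
  forall U : set X, open U -> C `<=` U -> U `&` A #= A.

Definition open_cover (X : topologicalType) (B : set X) (V : set (set X))
    : Prop :=
  V `<=` open /\ B `<=` \bigcup_(W in V) W.

Definition refines (X : Type) (V U : set (set X)) : Prop :=
  forall W : set X, V W -> exists2 W' : set X, U W' & W `<=` W'.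

Definition shrinkable_refinement (X : topologicalType) (V U : set (set X))
    : Prop :=
  forall W : set X, V W -> exists2 W' : set X, U W' & closure W `<=` W'.

Definition regular_refinement (X : topologicalType) (V U : set (set X))
    : Prop :=
  refines V U /\ shrinkable_refinement V V.

Definition regular_cover (X : topologicalType) (B : set X) (U : set (set X))
    : Prop :=
  open_cover B U /\
  exists V : set (set X), open_cover B V /\ regular_refinement V U.

Definition theta_omega_converges (X : topologicalType) (A B : set X) : Prop :=
  forall gamma : set (set X), regular_cover B gamma ->
    exists F : set (set X), [/\ finite_set F, F `<=` gamma &
      card_lt (A `\` \bigcup_(W in F) W) A].

(* Main.v *)
(** A regular space is RFC exactly when every regular filter base of open sets
is "caught" by its intersection: each open set containing the intersection
contains a member of the base.  If a map onto a regular space is not closed,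
the preimages of the neighbourhoods of a point in the closure of the image of a
closed set, but outside that image, violate this.  Conversely, collapse the
intersection of a regular filter base to a point whose neighbourhoods are
generated by the members of the base: the result is regular, and the collapsing
map is closed only if the base is caught.

Given catching, a regular cover of [X \ C] yields the regular filter base of
complements of closures of finite unions from its regular refinement, whose
intersection lies in [C].  For the converse, suppose no member of [FF] lies in
the open set [U] containing the intersection [C] of [FF].  Choose [A] of least
cardinality among the subsets of [X \ U] that meet every member of [FF].  Each
[A `&` F] is again such a set, so [|A `&` F| = |A|]; hence [A] does not
theta(omega)-converge to [X \ C], although [U] misses [A]. *)

Require Import Defs.
From HB Require Import structures.
From mathcomp Require Import all_boot all_order all_algebra.
From mathcomp Require Import all_classical all_reals all_analysis.

Set Implicit Arguments.
Unset Strict Implicit.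
Unset Printing Implicit Defensive.

Local Open Scope classical_set_scope.
Local Open Scope card_scope.

(** * Separation in regular and Hausdorff spaces *)

Lemma closure_min (X : topologicalType) (A D : set X) :
  closed D -> A `<=` D -> closure A `<=` D.
Proof. by move=> /closure_id cD AD; rewrite cD; exact: closureS. Qed.

Lemma regular_spaceP (X : topologicalType) :
  regular_space X <->
  forall (x : X) (U : set X), open U -> U x ->
    exists V : set X, [/\ open V, V x & closure V `<=` U].
Proof.
split=> [rX x U oU Ux|rX x U].
  have [V Vx VU] := rX x U (open_nbhs_nbhs (conj oU Ux)).
  move: Vx; rewrite nbhsE => -[W [oW Wx] WV].
  by exists W; split=> //; exact: subset_trans (closureS WV) VU.
rewrite nbhsE => -[W [oW Wx] WU].
have [V [oV Vx VW]] := rX x W oW Wx.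
by exists V; [exists V | exact: subset_trans VW WU].
Qed.

Lemma hausdorff_sep (X : topologicalType) (x y : X) : hausdorff_space X ->
  x <> y -> exists U : set X, [/\ open U, U x & ~ closure U y].
Proof.
rewrite open_hausdorff => hX /eqP xy.
have [[U V] /= [/set_mem Ux /set_mem Vy] [oU oV /eqP UV]] := hX x y xy.
exists U; split=> //; have UV' : U `<=` ~` V by exact/disjoints_subset.
by move=> /(closure_min (open_closedC oV) UV') /(_ Vy).
Qed.

Lemma regular_T1_hausdorff (X : topologicalType) : regular_space X ->
  (forall x y : X, x <> y -> exists2 U : set X, open U & U x /\ ~ U y) ->
  hausdorff_space X.
Proof.
move=> /regular_spaceP rX sep; rewrite open_hausdorff => x y /eqP xy.
have [U oU [Ux nUy]] := sep x y xy.
have [V [oV Vx VU]] := rX x U oU Ux.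
exists (V, ~` closure V); rewrite /= ?inE; first by split=> // /VU.
split=> //; first exact/closed_openC/closed_closure.
by apply/disjoints_subset; rewrite setCK; exact: subset_closure.
Qed.

(** * Regular filter bases of open sets *)

(** Members may be empty. When the intersection is empty, catching by the empty open set thus says
    that some member is empty. *)
Definition regular_filter_base (X : topologicalType) (FF : set (set X)) :=
  [/\ FF !=set0, FF `<=` open,
      forall F G, FF F -> FF G -> exists2 H, FF H & H `<=` F `&` G &
      forall F, FF F -> exists2 G, FF G & closure G `<=` F].

Lemma regular_filter_base_avoid (X : topologicalType) (FF : set (set X)) x :
  regular_filter_base FF -> ~ (\bigcap_(F in FF) F) x ->
  exists2 F, FF F & ~ closure F x.
Proof.
move=> [_ _ _ sh] nx; apply: contrapT => h; apply: nx => F FF_F.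
have [G FF_G GF] := sh F FF_F; apply: GF.
by apply: contrapT => nGx; apply: h; exists G.
Qed.

Lemma regular_filter_base_finite (X : topologicalType) (FF : set (set X))
    (G : set (set X)) : regular_filter_base FF -> finite_set G -> G `<=` FF ->
  exists2 F, FF F & F `<=` \bigcap_(W in G) W.
Proof.
move=> [FF0 _ dir _] /finite_fsetP[D ->] DFF.
have filFF : Filter (filter_from FF id) by exact: filter_from_filter.
apply: (@filter_bigI _ _ D id _ filFF) => W WD.
by exists W => //; exact: DFF.
Qed.

Lemma nbhs_regular_filter_base (X Y : topologicalType) (f : X -> Y) (y : Y) :
  regular_space Y -> continuous f ->
  regular_filter_base [set f @^-1` V | V in open_nbhs y].
Proof.
move=> /regular_spaceP rY /continuousP cf; split.
- by exists (f @^-1` setT); exists setT => //; split=> //; exact: openT.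
- by move=> _ [V [oV _] <-]; exact: cf.
- move=> _ _ [V Vy <-] [W Wy <-]; exists (f @^-1` (V `&` W)) => //.
  by exists (V `&` W) => //; exact: open_nbhsI.
- move=> _ [V [oV Vy] <-]; have [W [oW Wy WV]] := rY y V oV Vy.
  exists (f @^-1` W); first by exists W.
  apply: (@subset_trans _ (f @^-1` closure W)); last by move=> x; exact: WV.
  apply: closure_min; last exact: preimage_subset (@subset_closure _ W).
  by move: cf => /continuousP/continuous_closedP; apply; exact: closed_closure.
Qed.

Lemma bigcap_nbhs_preimage (X Y : topologicalType) (f : X -> Y) (y : Y) :
  hausdorff_space Y ->
  \bigcap_(F in [set f @^-1` V | V in open_nbhs y]) F = f @^-1` [set y].
Proof.
move=> hY; apply/seteqP; split=> [x hx|x /= <- _ [V [_ Vy] <-] //].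
apply: contrapT => /= fxy.
have /(hausdorff_sep hY)[U [oU Uy nUx]] : y <> f x by exact: nesym.
apply: nUx; apply: subset_closure.
by apply: (hx (f @^-1` U)); exists U.
Qed.

Definition filter_base_catching (X : topologicalType) :=
  forall (FF : set (set X)) (U : set X), regular_filter_base FF -> open U ->
    \bigcap_(F in FF) F `<=` U -> exists2 F, FF F & F `<=` U.

(** * Two constructions: a space with prescribed open sets, and a set of least cardinality *)

(** The map [r] picks representatives, so its range serves as the set of classes. Preimages commute
    with unions and intersections, hence the sets whose preimage lies in [op] form a topology.
    Leaving [op] free allows a topology coarser than the quotient one. *)
Lemma final_topology (X : choiceType) (r : X -> X) (op : set (set X)) :
  op setT -> (forall A B, op A -> op B -> op (A `&` B)) ->
  (forall (I : Type) (A : I -> set X), (forall i, op (A i)) ->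
    op (\bigcup_i A i)) ->
  exists (Y : topologicalType) (f : X -> Y),
    [/\ range f = setT, forall x y, f x = f y <-> r x = r y &
        forall U : set Y, open U <-> op (f @^-1` U)].
Proof.
move=> opT opI opU.
have rr x : r x \in range r by apply: mem_set; exists x.
pose T : choiceType := set_type (range r).
pose f x : T := exist _ (r x) (rr x).
pose opY : set (set T) := [set U | op (f @^-1` U)].
have opYT : opY setT by [].
have opYI : setI_closed opY by move=> A B; exact: opI.
have opYU (I : Type) (A : I -> set T) : (forall i, opY (A i)) ->
    opY (\bigcup_i A i).
  by move=> hA; rewrite /opY /= preimage_bigcup; exact: opU.
pose mix := @isOpenTopological.Build T opY opYT opYI opYU.
pose Y : topologicalType := HB.pack (set_type (range r)) mix.
exists Y, f; split=> //.
  apply/seteqP; split=> // -[y yr] _.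
  have /= [x _ rx] := set_mem yr.
  by exists x => //; apply: val_inj.
move=> x y; split=> [/(congr1 val) //|rxy]; exact: val_inj.
Qed.

(* Zorn's lemma gives a maximal set [Phi] of choice functions on [P] that differ
   pairwise at every member of [P].  By maximality, evaluation at some [A] in [P]
   maps [Phi] onto [A]; evaluation at any other [B] is injective. *)
Lemma min_card_exists (T : Type) (P : set (set T)) : P !=set0 ->
  exists2 A, P A & forall B, P B -> A #<= B.
Proof.
move=> [A0 PA0].
pose Q (Phi : set (set T -> T)) :=
  (forall phi B, Phi phi -> P B -> B (phi B)) /\
  (forall phi psi B, Phi phi -> Phi psi -> P B -> phi B = psi B -> phi = psi).
have [|Phi [[Phi_in Phi_inj] Phi_max]] := @Zorn_bigcup _ Q.
  move=> FF FQ tot; split=> [phi B [Phi FPhi]|phi psi B].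
    by have [+ _] := FQ _ FPhi; apply.
  move=> [Phi FPhi Phiphi] [Psi FPsi Psipsi].
  have [sub|sub] := tot _ _ FPhi FPsi.
  - by have [_] := FQ _ FPsi; apply=> //; exact: sub.
  - by have [_] := FQ _ FPhi; apply=> //; exact: sub.
have [A PA Asurj] : exists2 A, P A &
    forall a, A a -> exists2 phi, Phi phi & phi A = a.
  apply: contrapT => noA.
  have out A : P A -> exists a, A a /\ forall phi, Phi phi -> phi A <> a.
    move=> PA; apply: contrapT => h; apply: noA; exists A => // a Aa.
    apply: contrapT => h'; apply: h; exists a; split=> // phi Pphi phiA.
    by apply: h'; exists phi.
  have [t0 _] := out A0 PA0.
  have /choice[phi0 phi0P] A : exists a, P A ->
      A a /\ forall phi, Phi phi -> phi A <> a.
    by have [/out[a]|nPA] := pselect (P A); [exists a | exists t0].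
  apply: (Phi_max (Phi `|` [set phi0])).
    split=> [|sub]; first by move=> phi; left.
    have Phi0 : Phi phi0 by apply: sub; right.
    by have [_ /(_ _ Phi0)] := phi0P A0 PA0.
  split=> [phi B [|->] PB|phi psi B [Pphi|->] [Ppsi|->] PB //].
  - exact: Phi_in.
  - by have [] := phi0P B PB.
  - exact: Phi_inj.
  - by have [_ /(_ _ Pphi)] := phi0P B PB.
  - by move=> /esym; have [_ /(_ _ Ppsi)] := phi0P B PB.
exists A => // B PB.
have /choice[g gP] a : exists phi, A a -> Phi phi /\ phi A = a.
  have [/Asurj[phi ? ?]|nAa] := pselect (A a); first by exists phi.
  by exists (fun=> a).
have /injfunPex[f] : exists2 f : T -> T, set_fun A B f & set_inj A f.
  exists (fun a => g a B) => [a /gP[Pg _]|a b].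
    exact: Phi_in Pg PB.
  move=> /set_mem/gP[Pa ga] /set_mem/gP[Pb gb] /(Phi_inj _ _ _ Pa Pb PB) gab.
  by rewrite -ga gab gb.
exact: inj_card_le f.
Qed.

(** * Catching and complete accumulation *)

(** The complement of the intersection is an omega-hull of each of its points: start from a member
    whose closure avoids the point, shrink it repeatedly, and take the complements of the
    closures. *)
Lemma bigcap_theta_omega_closed (X : topologicalType) (FF : set (set X)) :
  regular_filter_base FF -> theta_omega_closed (\bigcap_(F in FF) F).
Proof.
move=> rFF; have [_ oFF _ sh] := rFF.
have bigcapE : \bigcap_(F in FF) F = \bigcap_(F in FF) closure F.
  apply/seteqP; split=> x hx F FF_F; first exact: subset_closure (hx F FF_F).
  by have [G FF_G] := sh F FF_F; apply; exact: hx.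
apply/seteqP; split=> x.
  move=> hx [U [[_ Ux] _]] /disjoints_subset UC.
  exact: UC hx.
move=> /= ncl; apply: contrapT => nx; apply: ncl.
exists (~` \bigcap_(F in FF) F); last by rewrite setICl.
split.
  split=> //; apply: closed_openC; rewrite bigcapE.
  by apply: closed_bigI => F _; exact: closed_closure.
have [F0 FF_F0 nF0] := regular_filter_base_avoid rFF nx.
have /choice[g gP] F : exists G, FF F -> FF G /\ closure G `<=` F.
  by have [/sh[G]|nF] := pselect (FF F); [exists G | exists F].
have FF_g n : FF (iter n g F0) by elim: n => //= n /gP[].
have gS n : closure (iter n.+1 g F0) `<=` iter n g F0.
  by have [] := gP _ (FF_g n).
exists (fun n => ~` closure (iter n g F0)) => n; split.
- split; first exact/closed_openC/closed_closure.
  elim: n => //= n IH; apply: contra_not IH => /gS.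
  exact: subset_closure.
- apply: (@subset_trans _ (~` iter n g F0)); last exact: subsetC.
  apply: closure_min; last exact/subsetC/subset_closure.
  exact/open_closedC/oFF.
- by rewrite bigcapE; apply: subsetC => z; apply.
Qed.

(** This cover is its own regular refinement: if the closure of [G] lies in [F], the closure of the
    complement of [closure F] misses [F], hence misses [closure G]. *)
Lemma closureC_regular_cover (X : topologicalType) (FF : set (set X)) :
  regular_filter_base FF ->
  regular_cover (~` \bigcap_(F in FF) F) [set ~` closure F | F in FF].
Proof.
move=> rFF; have [_ oFF _ sh] := rFF.
have cov : open_cover (~` \bigcap_(F in FF) F) [set ~` closure F | F in FF].
  split=> [_ [F _ <-]|x /(regular_filter_base_avoid rFF)[F FF_F nF]].
    exact/closed_openC/closed_closure.
  by exists (~` closure F) => //; exists F.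
split=> //; exists [set ~` closure F | F in FF]; split=> //; split.
  by move=> W; exists W.
move=> _ [F FF_F <-]; have [G FF_G GF] := sh F FF_F.
exists (~` closure G); first by exists G.
apply: (@subset_trans _ (~` F)); last exact: subsetC.
apply: closure_min; last exact/subsetC/subset_closure.
exact/open_closedC/oFF.
Qed.

Lemma accumulation_catching (X : topologicalType) :
  (forall A C : set X, infinite_set A -> theta_omega_closed C ->
     ~ theta_omega_converges A (~` C) -> complete_accumulation_set C A) ->
  filter_base_catching X.
Proof.
move=> acc FF U rFF oU capU; have [[F0 FF_F0] oFF dir _] := rFF.
apply: contrapT => noF.
pose meets (A : set X) := A `<=` ~` U /\ forall F, FF F -> A `&` F !=set0.
have [|A [AU Ameets] Amin] := @min_card_exists X meets.
  exists (~` U); split=> // F FF_F; apply: contrapT => h; apply: noF.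
  by exists F => // x Fx; apply: contrapT => nUx; apply: h; exists x.
have cardAF F : FF F -> A #<= A `&` F.
  move=> FF_F; apply: Amin; split=> [x [/AU]//|G FF_G].
  have [H FF_H HFG] := dir F G FF_F FF_G.
  by have [x [Ax /HFG[]]] := Ameets H FF_H; exists x.
(* Each point of [A] is outside [U], so outside the closure of some member. If [A] were finite, one
   member below all of these would miss [A]. *)
have infA : infinite_set A.
  move=> finA.
  have /choice[g gP] x : exists F, A x -> FF F /\ ~ closure F x.
    have [Ax|nAx] := pselect (A x); last by exists setT.
    have [|F FF_F nF] := regular_filter_base_avoid (x := x) rFF.
      by move=> /capU; exact: AU.
    by exists F.
  have [|_ [x Ax <-]|F FF_F Fg] := regular_filter_base_finite (G := g @` A) rFF.
  - exact: finite_image.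
  - by have [] := gP x Ax.
  - have [x [Ax Fx]] := Ameets F FF_F; have [_] := gP x Ax; apply.
    by apply: subset_closure; apply: (Fg x Fx); exists x.
(* Given finitely many sets of the cover, a single member [F] is disjoint from all of them; the part
   of [A] in [F], as large as [A], escapes their union. *)
have nconv : ~ theta_omega_converges A (~` \bigcap_(F in FF) F).
  move=> /(_ _ (closureC_regular_cover rFF))[G [finG GFF [_]]]; apply.
  have /choice[g gP] W : exists F, G W -> FF F /\ ~` closure F = W.
    by have [/GFF[F]|nGW] := pselect (G W); [exists F | exists setT].
  have [|_ [W GW <-]|F FF_F Fg] := regular_filter_base_finite (G := g @` G) rFF.
  - exact: finite_image.
  - by have [] := gP W GW.
  - apply: card_le_trans (cardAF F FF_F) (subset_card_le _) => x [Ax Fx].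
    split=> // -[W GW]; have [_ <-] := gP W GW; apply.
    by apply: subset_closure; apply: (Fg x Fx); exists W.
have := acc A _ infA (bigcap_theta_omega_closed rFF) nconv U oU capU.
have -> : U `&` A = set0 by rewrite setIC; exact/disjoints_subset.
rewrite card_eq_sym card_eq0 => /eqP A0.
by apply: infA; rewrite A0; exact: finite_set0.
Qed.

Lemma catching_accumulation (X : topologicalType) (A C : set X) :
  filter_base_catching X ->
  ~ theta_omega_converges A (~` C) -> complete_accumulation_set C A.
Proof.
move=> catch nconv U oU CU; apply: contrapT => nUA; apply: nconv => gamma.
move=> [[ogam covgam] [V [[oV covV] [ref shr]]]].
(* Replacing each set of a finite subfamily of [V] by its image under [g] enlarges the union past
   its closure; this is the shrinking property of [FF]. *)
have /choice[g gP] W : exists W', V W -> V W' /\ closure W `<=` W'.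
  by have [/shr[W']|nVW] := pselect (V W); [exists W' | exists set0].
have gV G : G `<=` V -> g @` G `<=` V by move=> GV _ [W /GV/gP[] ? _ <-].
have gcl G : finite_set G -> G `<=` V ->
    closure (\bigcup_(W in G) W) `<=` \bigcup_(W in g @` G) W.
  move=> finG GV; apply: (@subset_trans _ (\bigcup_(W in G) closure W)).
    apply: closure_min.
      by apply: closed_bigcup => // W _; exact: closed_closure.
    by move=> x [W GW Wx]; exists W => //; exact: subset_closure Wx.
  move=> x [W GW clWx]; exists (g W); first by exists W.
  by have [_] := gP W (GV W GW); apply.
pose FF := [set ~` closure (\bigcup_(W in G) W) |
              G in [set G | finite_set G /\ G `<=` V]].
have rFF : regular_filter_base FF.
  split.
  - exists (~` closure (\bigcup_(W in set0) W)); exists set0 => //.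
    by split; [exact: finite_set0 | exact: sub0set].
  - by move=> _ [G _ <-]; exact/closed_openC/closed_closure.
  - move=> _ _ [G [finG GV] <-] [H [finH HV] <-].
    exists (~` closure (\bigcup_(W in G `|` H) W)).
      by exists (G `|` H) => //; split; [rewrite finite_setU | rewrite subUset].
    by rewrite bigcup_setU closureU setCU.
  - move=> _ [G [finG GV] <-].
    exists (~` closure (\bigcup_(W in g @` G) W)).
      by exists (g @` G) => //; split; [exact: finite_image | exact: gV].
    apply: (@subset_trans _ (~` \bigcup_(W in g @` G) W)).
      apply: closure_min; last exact/subsetC/subset_closure.
      apply: open_closedC; apply: bigcup_open => W /(gV G GV); exact: oV.
    by apply: subsetC; exact: gcl.
have [|_ [G [finG GV] <-] GU] := catch FF U rFF oU.
  (* A point outside [U] is outside [C], so some [W] in [V] contains it; the one-set subfamily of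
     [W] gives a member of [FF] omitting it. *)
  move=> x capx; apply: contrapT => nUx.
  have [W VW Wx] : (\bigcup_(W in V) W) x by apply: covV => /CU.
  apply: (capx (~` closure (\bigcup_(W in [set W]) W))).
    by exists [set W] => //; split=> // _ ->.
  by rewrite bigcup_set1; exact: subset_closure Wx.
have /choice[h hP] W : exists W', V W -> gamma W' /\ W `<=` W'.
  by have [/ref[W']|nVW] := pselect (V W); [exists W' | exists set0].
(* Here [g] absorbs the closure in the caught member and [h] passes from [V] to [gamma]; what these
   finitely many sets leave of [A] lies in [U]. *)
exists (h @` (g @` G)); split.
- by do 2! apply: finite_image.
- by move=> _ [W /(gV G GV)/hP[] ? _ <-].
- have sub : A `\` \bigcup_(W in h @` (g @` G)) W `<=` U `&` A.
    move=> x [Ax nx]; split=> //; apply: GU => /(gcl G finG GV)[W gGW Wx].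
    apply: nx; exists (h W); first by exists W.
    by have [_] := hP W (gV G GV W gGW); apply.
  split=> [|AA]; first by apply: subset_card_le => x [].
  apply: nUA; apply: Cantor_Bernstein; first by apply: subset_card_le => x [].
  exact: card_le_trans AA (subset_card_le sub).
Qed.

(** * Catching and closed maps *)

Lemma catching_closed_map (X Y : topologicalType) (f : X -> Y) :
  filter_base_catching X -> regular_hausdorff Y -> continuous f ->
  closed_map f.
Proof.
move=> catch [rY hY] cf M cM y cly; apply: contrapT => nfM.
have [||_ [V Vy <-] VM] := catch _ (~` M) (nbhs_regular_filter_base y rY cf).
- exact: closed_openC.
- rewrite bigcap_nbhs_preimage // => x fxy Mx.
  by apply: nfM; exists x.
have [_ [[x Mx <-] Vx]] := cly V (open_nbhs_nbhs Vy).
exact: VM Vx Mx.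
Qed.

(* The space collapsing the intersection [B] to [p] does not carry the quotient
   topology: the neighbourhoods of the collapsed point are generated by [FF]. *)
Lemma collapse_catching (X : topologicalType) (FF : set (set X)) (U : set X) :
  RFC X -> regular_filter_base FF -> open U ->
  \bigcap_(F in FF) F !=set0 ->
  \bigcap_(F in FF) F `<=` U -> exists2 F, FF F & F `<=` U.
Proof.
move=> [[/regular_spaceP rX hX] rfcX] rFF oU [p Bp] BU.
have [FF0 oFF dir sh] := rFF.
set B := \bigcap_(F in FF) F in Bp BU.
pose r x := if pselect (B x) then p else x.
(* Testing at [p] suffices: a preimage under the collapsing map that meets [B] contains [p]. *)
pose op (V : set X) := open V /\ (V p -> exists2 F, FF F & F `<=` V).
have [|V W [oV Vp] [oW Wp]|I V oV|Y [f [fT fE oY]]] :=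
    @final_topology X r op.
- by split; [exact: openT | have [F FF_F] := FF0; exists F].
- split; [exact: openI|move=> [/Vp[F FF_F FV] /Wp[G FF_G GW]]].
  have [H FF_H HFG] := dir F G FF_F FF_G; exists H => //.
  exact: subset_trans HFG (setISS FV GW).
- split; first by apply: bigcup_open => i _; have [] := oV i.
  move=> [i _ Vip]; have [_ /(_ Vip)[F FF_F FV]] := oV i.
  by exists F => // x /FV; exists i.
have fB x y : f x = f y <-> x = y \/ B x /\ B y.
  rewrite fE /r; split; last first.
    by case=> [->//|[Bx By]]; case: pselect => //; case: pselect.
  case: pselect => Bx; case: pselect => By //; auto.
  - by move=> /= py; right; split=> //; rewrite -py.
  - by move=> /= xp; right; split=> //; rewrite xp.
(* Stronger than being a union of fibres: a set meeting [B] must contain a whole member of [FF], as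
   [op] demands. *)
pose saturated (V : set X) := (exists2 F, FF F & F `<=` V) \/ V `<=` ~` B.
have sat (V : set X) : saturated V -> f @^-1` (f @` V) = V.
  move=> sV; apply/seteqP; split=> [x [z Vz /fB[<- //|[Bz Bx]]]|x Vx].
    case: sV => [[F FF_F]|/(_ z Vz)//]; apply; exact: Bx.
  by exists x.
have oimage (V : set X) : open V -> saturated V -> open (f @` V).
  move=> oV sV; apply/oY; rewrite sat //; split=> // Vp.
  by case: sV => // /(_ p Vp).
have nclB F : FF F -> ~` closure F `<=` ~` B.
  by move=> FF_F x ncl Bx; apply: ncl; exact: subset_closure (Bx F FF_F).
have rY : regular_space Y.
  apply/regular_spaceP => y W oW; have [x _ <-] : range f y by rewrite fT.
  move=> Wfx; have [ofW Wp] := (oY W).1 oW.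
  (* With both sets saturated, the image of [V] is open, and so is that of the complement of
     [closure V]; the latter bounds the closure of the former inside [W]. *)
  have [V [[oV Vx VW] [sV snV]]] : exists V : set X,
      [/\ open V, V x & closure V `<=` f @^-1` W] /\
      (saturated V /\ saturated (~` closure V)).
    have [Bx|nBx] := pselect (B x).
      have [|F FF_F FW] := Wp; first by rewrite /= -(fB x p).2 //; right.
      have [G FF_G GF] := sh F FF_F; exists G; split; split.
      - exact: oFF.
      - exact: Bx.
      - exact: subset_trans GF FW.
      - by left; exists G.
      - by right; exact: nclB.
    have [F FF_F nFx] := regular_filter_base_avoid rFF nBx.
    have [|//|V [oV Vx VWF]] := rX x (f @^-1` W `&` ~` closure F).
      by apply: openI => //; exact/closed_openC/closed_closure.
    exists V; split; split=> //.
    - by move=> z /VWF[].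
    - by right=> z /subset_closure/VWF[_]; exact: nclB.
    - left; exists F => // z Fz /VWF[_]; apply; exact: subset_closure Fz.
  exists (f @` V); split; [exact: oimage | by exists x |].
  apply: (@subset_trans _ (~` (f @` (~` closure V)))).
    apply: closure_min => [|_ [z Vz <-] nclz].
      by apply/open_closedC/oimage => //; exact/closed_openC/closed_closure.
    have : (f @^-1` (f @` (~` closure V))) z by [].
    by rewrite sat //; apply; exact: subset_closure Vz.
  move=> y' ny'; have [z _ fz] : range f y' by rewrite fT.
  rewrite -fz; apply: VW; apply: contrapT => nVz.
  by apply: ny'; exists z.
have hY : hausdorff_space Y.
  apply: regular_T1_hausdorff => // y y'.
  have [x _ <-] : range f y by rewrite fT.
  have [x' _ <-] : range f y' by rewrite fT.
  move=> fxx'.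
  have [V [oV sV Vx nVx']] : exists V, [/\ open V, saturated V, V x & ~ V x'].
    have [Bx|nBx] := pselect (B x).
      have nBx' : ~ B x' by move=> Bx'; apply: fxx'; apply/fB; right.
      have [F FF_F nFx'] := regular_filter_base_avoid rFF nBx'.
      exists F; split; [exact: oFF | by left; exists F | exact: Bx |].
      by move=> /subset_closure.
    have [F FF_F nFx] := regular_filter_base_avoid rFF nBx.
    exists (~` closure F `&` ~` [set x']); split.
    - apply: openI; first exact/closed_openC/closed_closure.
      exact/closed_openC/accessible_closed_set1/hausdorff_accessible.
    - by right=> z [/(nclB F FF_F)].
    - by split=> // xx'; apply: fxx'; rewrite xx'.
    - by case=> _; apply.
  exists (f @` V); first exact: oimage.
  split; first by exists x.
  by move: nVx'; rewrite -{1}(sat V sV).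
have cf : continuous f by apply/continuousP => V /oY[].
(* The image of the complement of [U] is closed and omits the collapsed point, since [B] lies in
   [U]; openness around that point yields the member. *)
have := rfcX Y f (conj rY hY) cf fT (~` U) (open_closedC oU).
move=> /closed_openC/oY[_] [|F FF_F FU].
  by move=> [z nUz] /fB[zp|[Bz _]]; apply: nUz; apply: BU; rewrite ?zp.
exists F => // x /FU nUx; apply: contrapT => nU.
by apply: nUx; exists x.
Qed.

(* A filter base with empty intersection has no point to collapse to, so the
   neighbourhoods of an arbitrary point [p] are adjoined to its members. *)
Lemma RFC_catching (X : topologicalType) : RFC X -> filter_base_catching X.
Proof.
move=> rfcX FF U rFF oU BU; have [FF0 oFF dir sh] := rFF.
have [[/regular_spaceP rX hX] _] := rfcX.
have [B0|/set0P] := eqVneq (\bigcap_(F in FF) F) set0; last first.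
  by move=> B0; exact: collapse_catching.
have [[p]|noX] := pselect (exists x : X, True); last first.
  have [F FF_F] := FF0; exists F => // x; exfalso; apply: noX; by exists x.
move=> _.
have [F0 FF_F0 nF0p] : exists2 F, FF F & ~ closure F p.
  by apply: regular_filter_base_avoid => //; rewrite B0.
pose GG := [set F `|` W | F in FF & W in open_nbhs p].
have rGG : regular_filter_base GG.
  split.
  - have [F FF_F] := FF0; exists (F `|` setT); exists F => //.
    by exists setT => //; split=> //; exact: openT.
  - by move=> _ [F /oFF oF [W [oW _] <-]]; exact: openU.
  - move=> _ _ [F FF_F [W Wp <-]] [F' FF_F' [W' Wp' <-]].
    have [G FF_G GFF'] := dir F F' FF_F FF_F'.
    exists (G `|` (W `&` W')).
      by exists G => //; exists (W `&` W') => //; exact: open_nbhsI.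
    by move=> x [/GFF'[]|[]]; split; [left|left|right|right].
  - move=> _ [F FF_F [W [oW Wp] <-]].
    have [G FF_G GF] := sh F FF_F; have [V [oV Vp VW]] := rX p W oW Wp.
    exists (G `|` V); first by exists G => //; exists V.
    by rewrite closureU; exact: setUSS.
have GGp : (\bigcap_(G in GG) G) p.
  by move=> _ [F _ [W [_ Wp] <-]]; right.
(* The members of [GG] meet only in [p], which lies outside [closure F0]. Catching gives [F]
   disjoint from [F0], so a member below both is empty and lies in [U]. *)
have [||x GGx|_ [F FF_F [W [_ _] <-]] FW] :=
    @collapse_catching X GG (~` closure F0) rfcX rGG.
- exact/closed_openC/closed_closure.
- by exists p.
- suff -> : x = p by [].
  apply: contrapT => xp.
  have [F FF_F nFx] : exists2 F, FF F & ~ closure F x.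
    by apply: regular_filter_base_avoid => //; rewrite B0.
  have /(hausdorff_sep hX)[W [oW Wp nWx]] : p <> x by exact: nesym.
  have [|/subset_closure|/subset_closure] // := GGx (F `|` W).
  by exists F => //; exists W.
have [G FF_G GFF0] := dir F F0 FF_F FF_F0; exists G => // x /GFF0[Fx F0x].
by exfalso; apply: (FW x); [left | exact: subset_closure F0x].
Qed.

Theorem theorem7p7 (X : topologicalType) (hX : regular_hausdorff X) :
  RFC X <->
  (R_closed X /\
   forall A C : set X,
     infinite_set A -> theta_omega_closed C ->
     ~ theta_omega_converges A (~` C) ->
     complete_accumulation_set C A).
Proof.
split=> [/RFC_catching catch|[_ acc]].
  split=> [|A C _ _]; last exact: catching_accumulation.
  (* An embedding is continuous, hence closed by catching; its range is the image of the whole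
     space. *)
  split=> // Y f rhY [_ fP]; apply: (catching_closed_map catch rhY _ closedT).
  by apply/continuousP => V oV; apply/fP; exists V.
split=> // Y f rhY cf _; apply: catching_closed_map => //.
exact: accumulation_catching.
Qed.
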